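(* Consider the affine-in-control randomly switched system $$\dot x=f_\sigma(x,d)+\sum_{i=1}^m g_{\sigma,i}(x)u_i,\qquad x(0)=x_0,\quad t\ge0,$$ with control set $\mathcal C=\mathbb R^m$. Suppose that $\sigma$ belongs to class UH, with parameters $T>0$ and $q_j\in\,]0,1[$, $j\in\mathcal P$, and that there are continuously differentiable functions $V_i:\mathbb R^n\to\mathbb R_{\ge0}$, $i\in\mathcal P$, functions $\alpha_1,\alpha_2,\chi\in\mathcal K_\infty$, and numbers $\mu\ge1$ and $\lambda_i\in\mathbb R$, $i\in\mathcal P$, such that: (CUd1) $\alpha_1(\|x\|)\le V_i(x)\le\alpha_2(\|x\|)$ and $V_i(x)\le\mu V_j(x)$ for all $i,j\in\mathcal P$ and $x\in\mathbb R^n$; (CUd2) there exists a control function $k:\mathbb R^n\to\mathcal C$ such that $$\frac{\partial V_i}{\partial x}(x)\bigl(f_i(x,d)+g_i(x)k(x)\bigr)\le-\lambda_iV_i(x)+\chi(\|d\|)$$ for every $i\in\mathcal P$, $x\in\mathbb R^n$ and $d\in\mathbb R^k$, where $g_i(x)k(x):=\sum_{l=1}^m g_{i,l}(x)k_l(x)$; (CUd3) $\displaystyle\sum_{i\in\mathcal P}\frac{\mu q_i\bigl(1-e^{-\lambda_iT}\bigr)}{\lambda_iT}<1$. Then under the mode-independent feedback $u=k(x)$ the system, i.e. the closed-loop system $$\dot x=f_\sigma(x,d)+\sum_{i=1}^m g_{\sigma,i}(x)k_i(x),\qquad x(0)=x_0,\quad t\ge0,$$ satisfies an ISS in $L_1$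 estimate at switching instants.
   Context: Notation: $\mathbb N=\{1,2,\ldots\}$; $\mathbb R_{\ge 0}=[0,\infty[$; $\|\cdot\|$ is the Euclidean norm; $\|d\|_{A}$ is the essential supremum norm of $d$ on $A\subseteq\mathbb R_{\ge0}$. A function $\alpha:\mathbb R_{\ge0}\to\mathbb R_{\ge0}$ is in class $\mathcal K$ if it is (strictly) increasing, continuous and $\alpha(0)=0$; it is in class $\mathcal K_\infty$ if in addition it is unbounded. A function $\beta:\mathbb R_{\ge0}^2\to\mathbb R_{\ge0}$ is in class $\mathcal{KL}$ if $\beta(\cdot,s)\in\mathcal K$ for each $s$ and $\beta(r,s)\searrow 0$ as $s\to\infty$ for each $r$. For $\lambda_i=0$ the quotient $(1-e^{-\lambda_iT})/(\lambda_iT)$ is understood as its limit $1$. Setting: $(\Omega,\mathfrak F,\mathsf P)$ is a probability space. $\mathcal P=\{1,\ldots,\mathrm N\}$ is a finite index set; $f_j:\mathbb R^n\times\mathbb R^k\to\mathbb R^n$ and $g_{j,i}:\mathbb R^n\to\mathbb R^n$ are smooth for $j\in\mathcal P$, $i\in\{1,\ldots,m\}$; $u_1,\ldots,u_m$ are scalar controls and $u=[u_1,\ldots,u_m]^{\mathrm T}\in\mathcal C$; $k(x)=[k_1(x),\ldots,k_m(x)]^{\mathrm T}$. The disturbance $d:\mathbb R_{\ge0}\to\mathbb R^k$ is a deterministic function of time. Initial conditions satisfy $x_0\ne0$. A random switching signal $\sigma$ is a càdlàg stochastic process with values in $\mathcal P$ such that for each $t\ge0$ and $\omega\in\Omega$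 there is $\epsilon(t,\omega)>0$ with $\sigma(t+s,\omega)=\sigma(t,\omega)$ for $s\in[0,\epsilon(t,\omega)[$. Its switching instants are $0=\tau_0\le\tau_1\le\tau_2\le\cdots$, with $\sigma$ constant on each $[\tau_i,\tau_{i+1}[$ (consecutive values are allowed to coincide). Solutions are stochastic processes with locally absolutely continuous paths satisfying the differential equation for almost every $t$. Class UH: let $S_i:=\tau_i-\tau_{i-1}$, $i\in\mathbb N$, be the holding times. $\sigma$ belongs to class UH if (UH1) $(S_i)_{i\in\mathbb N}$ are i.i.d. random variables uniformly distributed on $[0,T]$ for some $T>0$; (UH2) $(\sigma(\tau_i))_{i\in\mathbb N\cup\{0\}}$ is i.i.d. with $\mathsf P(\sigma(\tau_i)=j)=q_j$ for some $q_j\in\,]0,1[$, $j\in\mathcal P$; (UH3) the sequences $(S_i)_{i\in\mathbb N}$ and $(\sigma(\tau_i))_{i\in\mathbb N}$ are mutually independent. ISS in $L_1$ estimate at switching instants: the closed-loop system satisfies such an estimate if there exist $\beta\in\mathcal{KL}$ and $\alpha,\gamma\in\mathcal K_\infty$ such that for every initial condition $x_0$ and every measurable essentially bounded $d$, $$\mathsf E\bigl[\alpha(\|x(\tau_\nu)\|)\bigr]\le\beta(\|x_0\|,\nu)+\gamma\bigl(\|d\|_{\mathbb R_{\ge0}}\bigr)$$ for all $\nu\in\mathbb N$ along solutions of the closed-loop system. *)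

(* Defs.v *)
From HB Require Import structures.
From mathcomp Require Export all_boot all_order all_algebra.
From mathcomp Require Export all_classical all_reals all_analysis.
From mathcomp Require Export ess_sup_inf.
Export Order.TTheory GRing.Theory Num.Theory.
Export numFieldNormedType.Exports.

Set Implicit Arguments.
Unset Strict Implicit.
Unset Printing Implicit Defensive.

Local Open Scope classical_set_scope.
Local Open Scope ring_scope.

(* The library norm on ['rV[R]_n] is the sup norm, hence this definition. *)
Definition enorm (R : realType) (n : nat) (x : 'rV[R]_n) : R :=
  Num.sqrt (\sum_(i < n) x ord0 i ^+ 2).

(* Functions on [0, +oo[ are represented by functions on [R] whose values at
   negative arguments are never constrained. Nonnegativity on [0, +oo[ follows
   from [alpha 0 = 0] and monotonicity. *)
Definition classK (R : realType) (alpha : R -> R) : Prop :=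
  [/\ alpha 0 = 0,
      forall r s : R, 0 <= r -> r < s -> alpha r < alpha s &
      {within `[0, +oo[, continuous alpha}].

Definition classKinf (R : realType) (alpha : R -> R) : Prop :=
  classK alpha /\ forall M : R, exists2 r : R, 0 <= r & M < alpha r.

Definition classKL (R : realType) (beta : R -> R -> R) : Prop :=
  (forall s : R, 0 <= s -> classK (beta ^~ s)) /\
  (forall r : R, 0 <= r ->
     (forall s t : R, 0 <= s -> s <= t -> beta r t <= beta r s) /\
     beta r s @[s --> +oo] --> (0 : R)).

(* In finite dimension, continuity of [x |-> 'd f x v] for each fixed [v] is
   continuity of the differential itself. *)
Fixpoint classC (R : realType) (U W : normedModType R) (m : nat) (f : U -> W)
    : Prop :=
  if m is m'.+1 then
    (forall x, differentiable f x) /\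
    (forall v, classC m' (fun x => 'd f x v))
  else continuous f.

Definition smooth (R : realType) (U W : normedModType R) (f : U -> W) : Prop :=
  forall m, classC m f.

(* Zero extension outside [A] is harmless since the norm is nonnegative. *)
Definition ess_norm (R : realType) (p : nat) (A : set R) (d : R -> 'rV[R]_p)
    : \bar R :=
  ess_sup (@lebesgue_measure R) ((fun t => (enorm (d t))%:E) \_ A).

Definition ess_bounded_disturbance (R : realType) (p : nat)
    (d : R -> 'rV[R]_p) : Prop :=
  (forall i, measurable_fun (`[0, +oo[ : set R) (fun t => d t ord0 i : R)) /\
  (ess_norm `[0%R, +oo[ d < +oo)%E.

Definition abs_continuous_on (R : realType) (n : nat) (a b : R)
    (y : R -> 'rV[R]_n) : Prop :=
  forall e : R, 0 < e -> exists2 delta : R, 0 < delta &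
    forall (K : nat) (l r : 'I_K -> R),
      (forall i, [/\ a <= l i, l i <= r i & r i <= b]) ->
      trivIset [set: 'I_K] (fun i => `]l i, r i[%classic) ->
      \sum_(i < K) (r i - l i) < delta ->
      \sum_(i < K) enorm (y (r i) - y (l i)) < e.

Definition locally_abs_continuous (R : realType) (n : nat)
    (y : R -> 'rV[R]_n) : Prop :=
  forall b : R, 0 <= b -> abs_continuous_on 0 b y.

Section Independence.
Context {dsp : measure_display} {Omega : measurableType dsp} {R : realType}.
Variable P : probability Omega R.

Definition independent_systems (I : eqType) (F : I -> set (set Omega)) : Prop :=
  forall (J : seq I) (A : I -> set Omega), uniq J ->
    (forall i, i \in J -> F i (A i)) ->
    P (\big[setI/setT]_(i <- J) A i) = (\prod_(i <- J) P (A i))%E.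

Definition independent2 (F G : set (set Omega)) : Prop :=
  forall A B, F A -> G B -> P (A `&` B) = (P A * P B)%E.

(* Here and below [B] is the sigma-algebra of the target space [E]. *)
Definition sigma_of (E : Type) (B : set (set E)) (X : Omega -> E)
    : set (set Omega) :=
  preimage_set_system setT X B.

Definition sigma_of_seq (E : Type) (B : set (set E)) (D : set nat)
    (X : nat -> Omega -> E) : set (set Omega) :=
  <<s \bigcup_(i in D) sigma_of B (X i) >>.

Definition random_element (E : Type) (B : set (set E)) (X : Omega -> E) : Prop :=
  sigma_of B X `<=` measurable.

End Independence.

Section SwitchedSystem.
Context {dsp : measure_display} {Omega : measurableType dsp} {R : realType}.
Variable P : probability Omega R.
Variable N : nat.

(* ['I_N] is discrete: its sigma-algebra is the full power set, and the
   existence of the left limit of a path means that the path is constant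
   on a left neighbourhood. Right-continuity is the last clause. *)
Definition random_switching_signal (sigma : R -> Omega -> 'I_N) : Prop :=
  [/\ forall t, 0 <= t -> random_element [set: set 'I_N] (sigma t),
      forall w t, 0 < t -> exists j, \forall s \near t^'-, sigma s w = j &
      forall w t, 0 <= t -> exists2 e : R, 0 < e &
        forall s, 0 <= s -> s < e -> sigma (t + s) w = sigma t w].

Definition switching_instants (sigma : R -> Omega -> 'I_N)
    (tau : nat -> Omega -> R) : Prop :=
  [/\ forall w, tau 0%N w = 0,
      forall i w, tau i w <= tau i.+1 w &
      forall i w t, tau i w <= t -> t < tau i.+1 w ->
        sigma t w = sigma (tau i w) w].

(* [holding_time tau i] is S_(i+1). *)
Definition holding_time (tau : nat -> Omega -> R) (i : nat) (w : Omega) : R :=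
  tau i.+1 w - tau i w.

Definition switch_value (sigma : R -> Omega -> 'I_N) (tau : nat -> Omega -> R)
    (i : nat) (w : Omega) : 'I_N :=
  sigma (tau i w) w.

(* In the last clause the values sigma(tau_i) are taken for i >= 1 only. *)
Definition classUH (sigma : R -> Omega -> 'I_N) (tau : nat -> Omega -> R)
    (T : R) (T_gt0 : 0 < T) (q : 'I_N -> R) : Prop :=
  let S := holding_time tau in
  let xi := switch_value sigma tau in
  [/\ [/\ forall i, random_element measurable (S i),
          independent_systems P (fun i => sigma_of measurable (S i)) &
          forall i B, measurable B ->
            P (S i @^-1` B) = uniform_prob T_gt0 B],
      [/\ forall j, 0 < q j < 1,
          forall i, random_element [set: set 'I_N] (xi i),
          independent_systems P (fun i => sigma_of [set: set 'I_N] (xi i)) &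
          forall i j, P (xi i @^-1` [set j]) = (q j)%:E] &
      independent2 P (sigma_of_seq measurable [set: nat] S)
        (sigma_of_seq [set: set 'I_N] [set i | (0 < i)%N] xi)].

Variables (n p : nat).

Definition solution (F : 'I_N -> 'rV[R]_n -> 'rV[R]_p -> 'rV[R]_n)
    (sigma : R -> Omega -> 'I_N) (d : R -> 'rV[R]_p) (x0 : 'rV[R]_n)
    (x : R -> Omega -> 'rV[R]_n) : Prop :=
  (forall t, 0 <= t -> forall i, measurable_fun setT (fun w => x t w ord0 i)) /\
  (forall w,
    [/\ x 0 w = x0,
        locally_abs_continuous (x ^~ w) &
        {ae (@lebesgue_measure R), forall t : R, 0 <= t ->
           is_derive t 1 (x ^~ w) (F (sigma t w) (x t w) (d t))}]).

Definition ISS_L1_at_switching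
    (F : 'I_N -> 'rV[R]_n -> 'rV[R]_p -> 'rV[R]_n)
    (sigma : R -> Omega -> 'I_N) (tau : nat -> Omega -> R) : Prop :=
  exists (beta : R -> R -> R) (alpha gamma : R -> R),
    [/\ classKL beta, classKinf alpha, classKinf gamma &
      forall (x0 : 'rV[R]_n) (d : R -> 'rV[R]_p) (x : R -> Omega -> 'rV[R]_n),
        x0 != 0 -> ess_bounded_disturbance d -> solution F sigma d x0 x ->
        forall nu : nat, (0 < nu)%N ->
          ('E_P[fun w => alpha (enorm (x (tau nu w) w))] <=
           (beta (enorm x0) nu%:R
            + gamma (fine (ess_norm `[0%R, +oo[ d)))%:E)%E].

End SwitchedSystem.

Definition affine_field (R : realType) (N n p m : nat)
    (f : 'I_N -> 'rV[R]_n * 'rV[R]_p -> 'rV[R]_n)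
    (g : 'I_N -> 'I_m -> 'rV[R]_n -> 'rV[R]_n)
    (j : 'I_N) (x : 'rV[R]_n) (d : 'rV[R]_p) (u : 'rV[R]_m) : 'rV[R]_n :=
  f j (x, d) + \sum_(l < m) u ord0 l *: g j l x.

Definition closed_loop (R : realType) (N n p m : nat)
    (f : 'I_N -> 'rV[R]_n * 'rV[R]_p -> 'rV[R]_n)
    (g : 'I_N -> 'I_m -> 'rV[R]_n -> 'rV[R]_n)
    (k : 'rV[R]_n -> 'rV[R]_m)
    (j : 'I_N) (x : 'rV[R]_n) (d : 'rV[R]_p) : 'rV[R]_n :=
  affine_field f g j x d (k x).

(* (1 - e^(-c)) / c, extended by its limit 1 at c = 0. *)
Definition one_minus_exp_quot (R : realType) (c : R) : R :=
  if c == 0 then 1 else (1 - expR (- c)) / c.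

(* Main.v *)
Require Import Defs.
From mathcomp Require Import ring lra measurable_realfun.

(** Write xi_i for the mode taken at the switching instant tau_i and
    S_i = tau_{i+1} - tau_i for the holding time that follows. On one holding
    interval the mode is constant, and the dissipation inequality integrates to
      V_{xi_i}(x(tau_{i+1})) <= exp(-lambda_{xi_i} S_i) V_{xi_i}(x(tau_i))
                                + chi(D) exp(Lam S_i),
    where D is the essential supremum of the disturbance and Lam is a constant
    ([holding_interval_bound]). Changing the mode costs at most a factor mu.
    Hence, path by path, V_{xi_i}(x(tau_i)) is dominated by the solution of a
    scalar affine recursion whose coefficients are functions of xi_i and S_i
    alone ([majorant_ge_path]). In the mean, one step of this recursion
    multiplies by
      eta = sum_j mu q_j (1 - exp(-lambda_j T)) / (lambda_j T) < 1,
    because the pair (xi_i, S_i) is independent of the earlier pairs, and it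
    adds a multiple of chi(D). So the mean is at most a geometric sequence
    plus a multiple of chi(D) ([majorant_expectation]), and the bounds on V by
    alpha1 and alpha2 turn this into the ISS estimate, with
    beta(r, s) = const rho^s alpha2(r) for some rho in ]eta, 1[ and
    gamma = const chi.

    Two points need care. First, xi_0 may depend on the holding times, since only
    the modes with index at least 1 are assumed independent of them; the first interval is therefore estimated with a rate Lam that
    serves every mode. Second, the paths are differentiable only almost
    everywhere, so the integration of the dissipation inequality rests on the
    monotonicity of absolutely continuous functions whose derivative is
    nonpositive almost everywhere ([nonincreasing_ae_derive]).

    The independence argument is carried by the predicate [decoupled a b Z e]:
    Z has mean e, and weighting by Z leaves the modes of index at least a and
    the holding times of index at least b independent, with the same laws.
    This is preserved by multiplying by a function of S_b (b becomes b + 1) or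
    by an indicator of xi_a (a becomes a + 1), which is all that the recursion
    uses. *)

Set Implicit Arguments.
Unset Strict Implicit.
Unset Printing Implicit Defensive.
Local Open Scope classical_set_scope.
Local Open Scope ring_scope.

(** * Monotonicity from an almost everywhere derivative bound *)

(** The supremum of the points reached by [Q] is crossed by the local step at
    that supremum, unless it is [b]. The step length may depend on the point,
    so this plays the part of a tagged-partition argument. *)
Lemma real_induction (R : realType) (a b : R) (Q : R -> Prop) :
  a <= b -> Q a ->
  (forall t, a <= t <= b -> exists2 e, 0 < e & forall s u,
     a <= s <= t -> t <= u <= b -> t - s < e -> u - t < e -> Q s -> Q u) ->
  Q b.
Proof.
move=> ab Qa step.
pose A := [set t | a <= t <= b /\ Q t].
have Aa : A a by split => //; rewrite lexx ab.
have hsA : has_sup A by split; [exists a | exists b => t [/andP[]]].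
have leA t : A t -> t <= sup A by move=> At; apply: ub_le_sup => //; case: hsA.
have supAb : sup A <= b by apply: ge_sup => [|t [/andP[]]] //; exists a.
have abA : a <= sup A <= b by rewrite supAb leA.
have [e e0 he] := step _ abA.
have [s As ss] := sup_adherent e0 hsA.
have sA := leA _ As.
case: As => /andP[as_ sb] Qs.
pose u := Num.min b (sup A + e / 2).
have supu : sup A <= u by rewrite le_min supAb lerDl divr_ge0 // ltW.
have ub : u <= b by rewrite ge_min lexx.
have Qu : Q u.
  apply: (he s) => //; rewrite ?as_ ?sA ?supu ?ub //.
    by rewrite ltrBlDr addrC -ltrBlDr.
  have : u <= sup A + e / 2 by rewrite ge_min lexx orbT.
  by lra.
have Au : A u by split => //; rewrite ub (le_trans as_ (le_trans sA supu)).
have := leA _ Au; rewrite /u /Num.min; case: ifP => [bl _|_].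
  by move: Qu; rewrite /u /Num.min bl.
by move=> h; exfalso; lra.
Qed.

(** Increments across a point of differentiability, rather than from it: this
    is the form that survives when the point lies inside a partition cell. *)
Lemma straddle_le (R : realType) (H : R -> R) (t v e : R) :
  is_derive t 1 H v -> v <= 0 -> 0 < e ->
  exists2 del, 0 < del & forall s u, s <= t -> t <= u ->
    t - s < del -> u - t < del -> H u - H s <= e * (u - s).
Proof.
move=> dH v0 e0.
have cv : h^-1 *: (H (h *: 1 + t) - H t) @[h --> 0^'] --> v.
  by rewrite -(@derive_val _ _ _ _ _ _ _ dH); exact: ex_derive.
move/cvgrPdist_lt : cv => /(_ _ e0) /nbhs_ballP [del /= del0 near_del].
have slope h : `|h| < del -> h != 0 -> h^-1 * (H (h + t) - H t) <= e.
  move=> hdel h0; have := near_del h; rewrite /ball /= sub0r normrN.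
  move=> /(_ hdel h0); rewrite ltr_distl /GRing.scale /= mulr1 => /andP[+ _].
  by lra.
exists del => // s u st tu sdel udel.
have right_part : H u - H t <= e * (u - t).
  have [->|ut] := eqVneq u t; first by rewrite !subrr mulr0.
  have ut0 : 0 < u - t by rewrite subr_gt0 lt_neqAle eq_sym ut.
  have := slope (u - t); rewrite gtr0_norm // => /(_ udel (lt0r_neq0 ut0)).
  by rewrite subrK ler_pdivrMl // mulrC.
have left_part : H t - H s <= e * (t - s).
  have [->|us] := eqVneq t s; first by rewrite !subrr mulr0.
  have ts0 : s - t < 0 by rewrite subr_lt0 lt_neqAle eq_sym us.
  have := slope (s - t); rewrite ltr0_norm // opprB => /(_ sdel (ltr0_neq0 ts0)).
  by rewrite subrK ler_ndivrMl //; lra.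
by lra.
Qed.

Lemma trivIset_itvoo (R : realType) K (l r : nat -> R) :
  (forall i j, (i < j < K)%N -> r i <= l j) ->
  trivIset [set: 'I_K] (fun i : 'I_K => `]l i, r i[%classic).
Proof.
move=> sorted i j _ _ [t [/= ti tj]].
move: ti tj; rewrite !in_itv /= => /andP[li ri] /andP[lj rj].
apply/val_inj; case: (ltngtP i j) => // ij.
- have := sorted i j; rewrite ij ltn_ord => /(_ isT) ril.
  by have := lt_trans (le_lt_trans ril lj) ri; rewrite ltxx.
- have := sorted j i; rewrite ij ltn_ord => /(_ isT) rjl.
  by have := lt_trans (le_lt_trans rjl li) rj; rewrite ltxx.
Qed.

Lemma total_length_le (R : realType) K (l r : 'I_K -> R) (U : set R) :
  open U -> (forall i, l i <= r i) ->
  (forall i, `]l i, r i[%classic `<=` U) ->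
  trivIset [set: 'I_K] (fun i => `]l i, r i[%classic) ->
  ((\sum_(i < K) (r i - l i))%:E <= (@lebesgue_measure R) U)%E.
Proof.
move=> oU lr sub tri.
rewrite -sumEFin.
rewrite (eq_bigr (fun i =>
  (@lebesgue_measure R) (`]l i, r i[%classic : set R))); last first.
  move=> i _; rewrite lebesgue_measure_itv /= lte_fin.
  case: ltP => // rl; have /eqP -> : r i - l i == 0; last by [].
  by rewrite subr_eq0 eq_le rl lr.
rewrite -(@measure_bigsetU_ord _ _ _ (@lebesgue_measure R) K xpredT
  (fun i => (`]l i, r i[%classic : set R))) //.
apply: le_measure; rewrite ?inE.
- by apply: bigsetU_measurable => i _; exact: measurable_itv.
- exact: open_measurable.
- elim/big_ind : _ => //= A B sA sB; by rewrite subUset.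
Qed.

Lemma ge0_enorm (R : realType) n (x : 'rV[R]_n) : 0 <= enorm x.
Proof. exact: sqrtr_ge0. Qed.

(** Fix e > 0 and enclose the exceptional null set in an open set [U] of small
    measure. Moving from [a] to [b] by real induction, cells around good points
    increase [H] by at most e times their length, while cells around bad points
    lie in [U]; absolute continuity of [y] makes their total contribution
    small. The hypothesis on [H] relative to [y] avoids proving that composites
    and products of absolutely continuous functions are absolutely
    continuous. *)
Lemma nonincreasing_ae_derive (R : realType) n (a b M : R) (y : R -> 'rV[R]_n)
    (H : R -> R) :
  a <= b -> 0 <= M -> abs_continuous_on a b y ->
  (forall l r, a <= l -> l <= r -> r <= b ->
     `|H r - H l| <= M * (enorm (y r - y l) + (r - l))) ->
  {ae (@lebesgue_measure R), forall t : R, a < t < b ->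
     exists2 v, v <= 0 & is_derive t 1 H v} ->
  H b <= H a.
Proof.
move=> ab M0 ACy HM [N [mN muN0 subN]].
have [->//|anb] := eqVneq a b.
have altb : a < b by rewrite lt_neqAle anb.
suff eps_bound e : 0 < e -> H b - H a <= e * (b - a) + M * (e + e).
  apply/ler_addgt0Pr => c c0.
  pose C := b - a + M * 2 + 1.
  have C0 : 0 < C by rewrite /C; lra.
  have := eps_bound (c / C) (divr_gt0 c0 C0).
  have eqc : c / C * C = c by rewrite divfK // gt_eqF.
  have cC : 0 < c / C by rewrite divr_gt0.
  set z := c / C in eqc cC *; rewrite /C in eqc; nra.
move=> e0.
have [delta delta0 hdelta] := ACy _ e0.
(* The end points join the null set, so that good points are interior. *)
pose N' := N `|` ([set a] `|` [set b]).
have mN' : measurable N' by apply: measurableU => //; exact: measurableU.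
have muN' : (@lebesgue_measure R) N' = 0%E.
  rewrite measureU0 //=; first by apply: measurableU.
  by apply: countable_lebesgue_measure0; exact: finite_set_countable.
pose rho := Num.min delta e.
have rho0 : 0 < rho by rewrite lt_min delta0.
have [U [oU N'U muU]] : exists U : set R,
    [/\ open U, N' `<=` U & ((@lebesgue_measure R) U < rho%:E)%E].
  have muN'oo : ((@lebesgue_measure R) N' < +oo)%E by rewrite muN' ltry.
  have [U [oU N'U muU]] := lebesgue_regularity_outer mN' muN'oo rho0.
  exists U; split => //; apply: le_lt_trans muU.
  have mU := open_measurable oU.
  have : ((@lebesgue_measure R) (N' `|` U `\` N') <=
          (@lebesgue_measure R) N' + (@lebesgue_measure R) (U `\` N'))%E.
    by apply: measureU2 => //; exact: measurableD.
  by rewrite setDUK // muN' add0e.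
(* The recorded intervals [l i, r i] are the cells around bad points, listed
   from left to right; all other cells are paid for by e * (c - a). *)
pose Q c := exists (K : nat) (l r : nat -> R),
  [/\ forall i, (i < K)%N -> [/\ a <= l i, l i <= r i, r i <= c &
                               `]l i, r i[%classic `<=` U],
      forall i j, (i < j < K)%N -> r i <= l j &
      H c - H a <= e * (c - a) + \sum_(i < K) `|H (r i) - H (l i)|].
have [K [l [r [lr sorted Hb]]]] : Q b.
  apply: (real_induction ab).
    exists 0%N, (fun=> 0), (fun=> 0); split => //.
    by rewrite big_ord0 !subrr mulr0 addr0.
  move=> t /andP[at_ tb]; have [tU|tU] := pselect (U t).
    have [del /= del0 ballU] := @open_nbhs_nbhs _ _ _ (conj oU tU).
    exists del => // s u /andP[as_ st] /andP[tu ub] sdel udel.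
    move=> [K [l [r [lr sorted Hs]]]].
    exists K.+1, (fun i => if i == K then s else l i),
                 (fun i => if i == K then u else r i); split.
    - move=> i; rewrite ltnS leq_eqVlt; case: eqVneq => /= [_ _|_ iK].
        split => //; first exact: le_trans tu.
        move=> z /=; rewrite in_itv /= => /andP[sz zu].
        by apply: ballU; rewrite /ball_ /= ltr_norml; lra.
      by have [ali liri ris sub] := lr _ iK; split => //; lra.
    - move=> i j /andP[ij]; rewrite ltnS leq_eqVlt => /orP[/eqP jK|jK].
        rewrite jK eqxx ltn_eqF -?jK //.
        by have [] := lr i; rewrite -?jK.
      rewrite !ltn_eqF ?(ltn_trans ij) //; apply: sorted.
      by rewrite ij.
    - rewrite big_ord_recr /= eqxx (eq_bigr (fun i : 'I_K => `|H (r i) - H (l i)|)).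
        by have := ler_norm (H u - H s); nra.
      by move=> i _; rewrite ltn_eqF.
  have tab : a < t < b.
    rewrite !lt_neqAle at_ tb !andbT; apply/andP; split; apply/negP => /eqP tE.
      by apply/tU/N'U; right; left; rewrite /= tE.
    by apply/tU/N'U; right; right; rewrite /= tE.
  have [v v0 dH] : exists2 v, v <= 0 & is_derive t 1 H v.
    apply: contrapT => nodH; apply/tU/N'U; left; apply: subN => /= ht.
    by apply: nodH; exact: ht.
  have [del del0 hdel] := straddle_le dH v0 e0.
  exists del => // s u /andP[as_ st] /andP[tu ub] sdel udel.
  move=> [K [l [r [lr sorted Hs]]]].
  exists K, l, r; split => //.
    by move=> i iK; have [? ? ? ?] := lr _ iK; split => //; lra.
  by have := hdel s u st tu sdel udel; lra.
have tri := trivIset_itvoo sorted.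
have short : \sum_(i < K) (r i - l i) < rho.
  rewrite -lte_fin; apply: le_lt_trans muU.
  apply: (@total_length_le _ K (l \o val) (r \o val)) => // i;
    by have [] := lr i (ltn_ord i).
have incr : \sum_(i < K) enorm (y (r i) - y (l i)) < e.
  apply: (hdelta K (l \o val) (r \o val)) => //=.
    by move=> i; have [] := lr i (ltn_ord i).
  by apply: lt_le_trans short _; rewrite ge_min lexx.
apply: le_trans Hb _; rewrite lerD2l.
apply: (@le_trans _ _ (\sum_(i < K) M * (enorm (y (r i) - y (l i)) + (r i - l i)))).
  by apply: ler_sum => i _; have [? ? ? _] := lr i (ltn_ord i); exact: HM.
rewrite -mulr_sumr big_split /=; apply: ler_wpM2l => //.
have : rho <= e by rewrite ge_min lexx orbT.
by lra.
Qed.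

(** * Integration of the dissipation inequality along a path *)

Lemma is_derive1_diff_comp (R : realType) n (W : 'rV[R]_n -> R)
    (z : R -> 'rV[R]_n) (t : R) (v : 'rV[R]_n) :
  differentiable W (z t) -> is_derive t 1 z v ->
  is_derive t 1 (W \o z) ('d W (z t) v).
Proof.
move=> dW dz.
have dz' : differentiable z t by apply/derivable1_diffP; exact: ex_derive.
have dWz : differentiable (W \o z) t by exact: differentiable_comp.
apply: DeriveDef; first exact/derivable1_diffP.
rewrite deriveE // diff_comp //=.
by congr ('d W (z t) _); rewrite -deriveE // derive_val.
Qed.

Lemma normr_le_enorm (R : realType) n (x : 'rV[R]_n) i : `|x ord0 i| <= enorm x.
Proof.
rewrite /enorm -sqrtr_sqr ler_wsqrtr // (bigD1 i) //= lerDl.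
by apply: sumr_ge0 => j _; exact: sqr_ge0.
Qed.

Lemma cube_compact (R : realType) n (M : R) :
  compact [set v : 'rV[R]_n | forall i, `|v ord0 i| <= M].
Proof.
have := @rV_compact R n (fun=> `[- M, M]%classic) (fun=> @segment_compact _ _ _).
by congr compact; apply/seteqP; split => v /= h i; have := h i;
  rewrite in_itv /= ler_norml.
Qed.

Lemma cube_bounded (R : realType) n (M : R) (G : 'rV[R]_n -> R) :
  0 <= M -> continuous G ->
  exists2 C : R, 0 <= C & forall x : 'rV[R]_n,
    (forall i, `|x ord0 i| <= M) -> `|G x| <= C.
Proof.
move=> M0 cG; pose A := [set v : 'rV[R]_n | forall i, `|v ord0 i| <= M].
have A0 : A !=set0 by exists 0 => i; rewrite mxE normr0.
have cG' : {within A, continuous (fun x => `|G x|)}.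
  apply: continuous_subspaceT => x.
  by apply: continuous_comp; [exact: cG | exact: norm_continuous].
have [c _ hc] := EVT_max_rV A0 (@cube_compact R n M) cG'.
exists `|G c| => // x xM; apply: hc; exact: mem_set.
Qed.

(** Mean value theorem along the segment, which stays in the cube; the partial
    derivatives are bounded there by compactness. *)
Lemma C1_lipschitz_cube (R : realType) n (M : R) (W : 'rV[R]_n -> R) :
  0 <= M -> classC 1 W ->
  exists2 L : R, 0 <= L & forall x y : 'rV[R]_n,
    (forall i, `|x ord0 i| <= M) -> (forall i, `|y ord0 i| <= M) ->
    `|W y - W x| <= L * enorm (y - x).
Proof.
move=> M0 [/= dW cdW].
have bounds i := cube_bounded M0 (cdW (delta_mx ord0 i)).
pose C i := s2val (cid2 (bounds i)).
have C0 i : 0 <= C i by exact: (s2valP (cid2 (bounds i))).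
have CP i (x : 'rV[R]_n) : (forall i, `|x ord0 i| <= M) ->
    `|'d W x (delta_mx ord0 i)| <= C i.
  exact: (s2valP' (cid2 (bounds i))).
exists (\sum_(i < n) C i) => [|x y xM yM]; first exact: sumr_ge0.
pose z := fun s : R => x + s *: (y - x).
have dz (s : R) : is_derive s 1 z (y - x).
  have scalel : is_derive s 1 ( *:%R^~ (y - x) : R -> 'rV[R]_n) (y - x).
    apply: DeriveDef; first exact/derivable1_diffP.
    by rewrite deriveE // diff_val scale1r.
  by apply: is_derive_eq (add0r _); exact: is_deriveD.
have dWz (s : R) : is_derive s 1 (W \o z) ('d W (z s) (y - x)).
  exact: is_derive1_diff_comp.
have cWz : {within `[0, 1], continuous (W \o z)}.
  apply: continuous_subspaceT => s; apply: differentiable_continuous.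
  by apply/derivable1_diffP; exact: ex_derive.
have [c] := MVT_segment ler01 (fun s _ => dWz s) cWz.
rewrite in_itv /= => /andP[c0 c1].
rewrite /= /z scale0r addr0 scale1r subr0 mulr1 (addrC x) subrK => ->.
have zM i : `|(x + c *: (y - x)) ord0 i| <= M.
  have := xM i; have := yM i; rewrite !mxE !ler_norml; nra.
rewrite [X in 'd W _ X](row_sum_delta (y - x)) linear_sum /=.
apply: le_trans (ler_norm_sum _ _ _) _.
rewrite mulr_suml; apply: ler_sum => i _.
rewrite linearZ /= normrM mulrC.
by apply: ler_pM => //; [exact: CP | exact: normr_le_enorm].
Qed.

(** Real induction again, with the modulus of absolute continuity for the
    increment 1 as a uniform step. *)
Lemma abs_continuous_bounded (R : realType) n (a b : R) (y : R -> 'rV[R]_n) :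
  a <= b -> abs_continuous_on a b y ->
  exists2 M : R, 0 <= M & forall t i, a <= t <= b -> `|y t ord0 i| <= M.
Proof.
move=> ab ACy.
have [del del0 hdel] := ACy 1 ltr01.
have osc s t : a <= s -> s <= t -> t <= b -> t - s < del ->
    enorm (y t - y s) < 1.
  move=> as_ st tb tsdel.
  have := hdel 1%N (fun=> s) (fun=> t); rewrite !big_ord1; apply => //.
  by move=> i j _ _ _; rewrite !ord1.
suff [M [M0 HM]] : exists M : R, 0 <= M /\
    forall t i, a <= t <= b -> `|y t ord0 i| <= M by exists M.
apply: (real_induction ab (Q := fun c => exists M : R, 0 <= M /\
    forall t i, a <= t <= c -> `|y t ord0 i| <= M)).
  exists (enorm (y a)); split; first exact: ge0_enorm.
  move=> t i; rewrite -eq_le => /eqP <-; exact: normr_le_enorm.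
move=> t0 _; exists (del / 2) => [|s u]; first by rewrite divr_gt0.
move=> /andP[as_ st0] /andP[t0u ub] st ut [M [M0 HM]].
exists (M + 1); split => [|t i /andP[at_ tu]]; first by rewrite addr_ge0.
have [ts|ts] := leP t s.
  by apply: le_trans (HM t i _) _; rewrite ?at_ ?ts // lerDl.
have -> : y t ord0 i = y s ord0 i + (y t - y s) ord0 i.
  by rewrite !mxE addrCA subrr addr0.
apply: le_trans (ler_normD _ _) (lerD _ _); first by rewrite HM // as_ lexx.
apply: le_trans (normr_le_enorm _ _) (ltW _).
by apply: osc => //; lra.
Qed.

Lemma is_derive_affine (R : realType) (la a t : R) :
  is_derive t 1 (fun t => la * (t - a)) la.
Proof.
have := is_deriveZ la (is_deriveB (is_derive_id t 1) (is_derive_cst a t 1)).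
by rewrite subr0 /GRing.scale /= mulr1.
Qed.

Lemma expR_weight_lipschitz (R : realType) (la Lam a b l r : R) :
  `|la| <= Lam -> a <= l -> l <= r -> r <= b ->
  `|expR (la * (r - a)) - expR (la * (l - a))| <=
    Lam * expR (Lam * (b - a)) * (r - l).
Proof.
move=> laLam al lr rb.
have Lam0 : 0 <= Lam by exact: le_trans laLam.
have de (t : R) : is_derive t 1 (fun t => expR (la * (t - a)))
    (expR (la * (t - a)) * la).
  exact: (is_derive1_comp (is_derive_expR _) (is_derive_affine _ _ _)).
have [|c + ->] := MVT_segment lr (fun t _ => de t).
  apply: continuous_subspaceT => s; apply: differentiable_continuous.
  by apply/derivable1_diffP; exact: ex_derive.
rewrite in_itv /= => /andP[lc cr].
rewrite !normrM (ger0_norm (expR_ge0 _)) (@ger0_norm _ (r - l)); last lra.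
apply: ler_wpM2r; first lra.
rewrite mulrC ler_pM ?expR_ge0 // ler_expR.
move: laLam; rewrite ler_norml => /andP[]; nra.
Qed.

(** Integrating-factor argument: exp(la (t - a)) W(x t) - c E (t - a), with [E]
    a bound for the weight, has nonpositive derivative almost everywhere. The
    resulting remainder c E (b - a) exp(-la (b - a)) is bounded by a single
    exponential of the length, uniformly in [la], which is the form needed
    when the length is random. *)
Lemma dissipation_bound (R : realType) n (W : 'rV[R]_n -> R)
    (x : R -> 'rV[R]_n) (a b la Lam c : R) :
  classC 1 W -> a <= b -> abs_continuous_on a b x -> `|la| <= Lam -> 0 <= c ->
  {ae (@lebesgue_measure R), forall t : R, a < t < b ->
     exists2 v, is_derive t 1 x v & 'd W (x t) v <= - la * W (x t) + c} ->
  W (x b) <= expR (- la * (b - a)) * W (x a)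
             + c * expR ((Lam * 2 + 1) * (b - a)).
Proof.
move=> W1 ab ACx laLam c0 dx.
have Lam0 : 0 <= Lam by exact: le_trans laLam.
have [M M0 xM] := abs_continuous_bounded ab ACx.
have [L L0 WL] := C1_lipschitz_cube M0 W1.
have cW : continuous W by move=> z; apply: differentiable_continuous; apply: W1.1.
have [B B0 WB] := cube_bounded M0 cW.
pose w t := expR (la * (t - a)).
pose E := expR (Lam * (b - a)).
have E0 : 0 < E by exact: expR_gt0.
have wE t : a <= t <= b -> 0 < w t <= E.
  move=> tab; rewrite expR_gt0 ler_expR /=.
  move: laLam; rewrite ler_norml => /andP[]; nra.
pose H t := w t * W (x t) - c * E * (t - a).
have : H b <= H a.
  apply: (@nonincreasing_ae_derive _ _ _ _ (E * L + Lam * E * B + c * E) x) => //.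
  - by rewrite !addr_ge0 // !mulr_ge0 // ltW.
  - move=> l r al lr rb.
    have -> : H r - H l = w r * (W (x r) - W (x l)) + (w r - w l) * W (x l)
                          + (- (c * E * (r - l))) by rewrite /H; ring.
    have rab : a <= r <= b by lra.
    have lab : a <= l <= b by lra.
    have h1 : `|w r * (W (x r) - W (x l))| <= E * (L * enorm (x r - x l)).
      have [/ltW w0 wrE] := andP (wE r rab).
      rewrite normrM (ger0_norm w0); apply: ler_pM => //.
      by apply: WL => i; exact: xM.
    have h2 : `|(w r - w l) * W (x l)| <= Lam * E * (r - l) * B.
      rewrite normrM; apply: ler_pM => //; first exact: expR_weight_lipschitz.
      by apply: WB => i; exact: xM.
    have h3 : `|- (c * E * (r - l))| <= c * E * (r - l).
      by rewrite normrN ger0_norm // mulr_ge0 ?mulr_ge0 ?(ltW E0) // subr_ge0.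
    have h12 := le_trans (ler_normD _ _) (lerD h1 h2).
    have h := le_trans (ler_normD _ _) (lerD h12 h3).
    apply: le_trans h _.
    have e0 := ge0_enorm (x r - x l).
    have p1 : 0 <= E * L by rewrite mulr_ge0 // ltW.
    have p2 : 0 <= Lam * E * B by rewrite !mulr_ge0 // ltW.
    have p3 : 0 <= c * E by rewrite mulr_ge0 // ltW.
    have rl : 0 <= r - l by lra.
    rewrite -subr_ge0.
    set e := enorm _ in e0 *; set P1 := E * L in p1 *.
    have -> : (P1 + Lam * E * B + c * E) * (e + (r - l)) -
       (E * (L * e) + Lam * E * (r - l) * B + c * E * (r - l)) =
       P1 * (r - l) + Lam * E * B * e + c * E * e by rewrite /P1; ring.
    by rewrite !addr_ge0 // mulr_ge0.
  - have [N [mN muN0 subN]] := dx.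
    exists N; split => //; apply: subset_trans subN; apply: subsetC => t /= ht tab.
    have [v dxt hv] := ht tab.
    have dw : is_derive t 1 w (w t * la).
      exact: (is_derive1_comp (is_derive_expR _) (is_derive_affine _ _ _)).
    have dWx := is_derive1_diff_comp (W1.1 (x t)) dxt.
    have dlin : is_derive t 1 (fun t => c * E * (t - a)) (c * E).
      exact: is_derive_affine.
    exists (w t * 'd W (x t) v + W (x t) * (w t * la) - c * E).
      have tab' : a <= t <= b by lra.
      have [w0 wE'] := andP (wE t tab').
      by nra.
    have := is_deriveB (is_deriveM dw dWx) dlin.
    exact.
rewrite /H {2}/w subrr !mulr0 expR0 mul1r subr0 lerBlDr => Hb.
have expN : expR (- la * (b - a)) = (w b)^-1.
  by rewrite /w mulNr expRN.
have wb0 : 0 < w b by exact: expR_gt0.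
rewrite expN -(ler_pM2l wb0) mulrDr mulrA divff ?gt_eqF // mul1r.
apply: le_trans Hb _; rewrite lerD2l.
rewrite mulrCA -mulrA; apply: ler_wpM2l => //.
have -> : w b * expR ((Lam * 2 + 1) * (b - a)) =
    E * expR ((la + Lam) * (b - a) + (b - a)).
  by rewrite /w /E -!expRD; congr expR; ring.
rewrite ler_pM2l //.
have : (b - a) <= expR (b - a) by have := expR_ge1Dx (b - a); lra.
move=> h; apply: le_trans h _; rewrite ler_expR lerDr mulr_ge0 ?subr_ge0 //.
by move: laLam; rewrite ler_norml; lra.
Qed.

(** * Propagation of independence through expectations *)

Section integral_decouple.
Local Open Scope ereal_scope.
Context (d1 d2 : measure_display) (Omega : measurableType d1)
  (E : measurableType d2) (R : realType).
Variables (P : {measure set Omega -> \bar R}) (nu : {measure set E -> \bar R}).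
Variables (F : set Omega) (X : Omega -> E) (Z : Omega -> R) (c : \bar R).
Hypotheses (mF : measurable F) (mX : measurable_fun setT X)
  (mZ : measurable_fun setT Z) (Z_ge0 : forall w, (0 <= Z w)%R)
  (c_ge0 : 0 <= c) (c_fin : c \is a fin_num).
Hypothesis decoupled_sets : forall B, measurable B ->
  \int[P]_(w in F `&` X @^-1` B) (Z w)%:E = c * nu B.

Import HBNNSimple.

Let measurable_comp (g : E -> R) : measurable_fun setT g ->
  measurable_fun F (fun w => (g (X w) * Z w)%R%:E).
Proof.
move=> mg; apply/measurable_EFinP; apply: measurable_funTS.
by apply: measurable_funM => //; exact: measurableT_comp mg mX.
Qed.

Lemma integral_decouple_nnsfun (g : {nnsfun E >-> R}) :
  \int[P]_(w in F) (g (X w) * Z w)%R%:E = c * \int[nu]_t (g t)%:E.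
Proof.
have mX' B : measurable B -> measurable (X @^-1` B).
  by move=> mB; rewrite -[_ @^-1` _]setTI; exact: mX.
rewrite integralT_nnsfun sintegralE ge0_mule_fsumr; last first.
  by move=> r; exact: nnsfun_mulemu_ge0.
transitivity (\int[P]_(w in F) \sum_(r \in range g)
    (r * \1_(g @^-1` [set r]) (X w) * Z w)%:E).
  apply: eq_integral => w _; rewrite [in LHS]fimfunE fsumEFin //.
  by rewrite mulr_fsuml.
rewrite ge0_integral_fsum //; last 2 first.
- by move=> r; apply: (measurable_comp (g := fun t => r * \1_(g @^-1` [set r]) t)%R);
    exact: measurable_funM.
- move=> r w _; rewrite lee_fin mulr_ge0 //.
  by have := nnfun_muleindic_ge0 g r (X w); rewrite lee_fin.
apply: eq_fsbigr => r _; rewrite muleCA -decoupled_sets //.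
have [r0|r0] := ltP r 0%R.
  rewrite preimage_nnfun0 // preimage_set0 setI0 integral_set0 mule0.
  by apply: integral0_eq => w _; rewrite indic0 mulr0 mul0r.
rewrite integral_mkcondr -ge0_integralZl_EFin //; last first.
- apply: measurable_funTS; apply/(measurable_restrictT _ _).1; first exact: mX'.
  by apply: measurable_funTS; exact/measurable_EFinP.
- by move=> w _; rewrite /patch; case: ifP => //; rewrite lee_fin.
apply: eq_integral => w _; rewrite -mulrA EFinM; congr (_ * _).
rewrite /patch indicE.
have -> : (w \in X @^-1` (g @^-1` [set r])) = (X w \in g @^-1` [set r]) by [].
by case: ifP => _; rewrite ?mul1r ?mul0r.
Qed.

(** The hypothesis says that the law of [X] under the measure with density [Z]
    on [F] is [c] times [nu]; agreement on sets passes to simple functions by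
    linearity and to nonnegative functions by monotone convergence. *)
Lemma integral_decouple (phi : E -> R) :
  measurable_fun setT phi -> (forall t, (0 <= phi t)%R) ->
  \int[P]_(w in F) (phi (X w) * Z w)%R%:E = c * \int[nu]_t (phi t)%:E.
Proof.
move=> mphi phi0.
have mphi' : measurable_fun setT (EFin \o phi) by exact/measurable_EFinP.
pose f_ := nnsfun_approx measurableT mphi'.
have f_cvg t : (f_ n t)%:E @[n --> \oo] --> (phi t)%:E.
  by apply: (cvg_nnsfun_approx measurableT mphi') => // s _; rewrite lee_fin.
have f_nd t m n : (m <= n)%N -> (f_ m t <= f_ n t)%R.
  by move=> mn; exact/lefP/nd_nnsfun_approx.
transitivity (limn (fun n => \int[P]_(w in F) (f_ n (X w) * Z w)%R%:E)).
  rewrite -monotone_convergence //; last 3 first.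
  - by move=> n; exact: measurable_comp.
  - by move=> n w _; rewrite lee_fin mulr_ge0.
  - by move=> w _ m n mn; rewrite lee_fin ler_wpM2r // f_nd.
  apply: eq_integral => w _; apply/esym/cvg_lim => //.
  under eq_fun do rewrite EFinM.
  by rewrite EFinM; apply: cvgeZr => //; exact: f_cvg.
under eq_fun do rewrite integral_decouple_nnsfun.
have int_cvg : \int[nu]_t (f_ n t)%:E @[n --> \oo] --> \int[nu]_t (phi t)%:E.
  have -> : \int[nu]_t (phi t)%:E = \int[nu]_t limn (fun n => (f_ n t)%:E).
    by apply: eq_integral => t _; apply/esym/cvg_lim => //; exact: f_cvg.
  apply: cvg_monotone_convergence => //.
  - by move=> n; exact/measurable_EFinP.
  - by move=> n t _; rewrite lee_fin.
  - by move=> t _ m n mn; rewrite lee_fin f_nd.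
by apply/cvg_lim => //; exact: cvgeZl.
Qed.

End integral_decouple.

Section decoupled.
Local Open Scope ereal_scope.
Context (dsp : measure_display) (Omega : measurableType dsp) (R : realType)
  (P : probability Omega R) (N : nat).
Variables (S : nat -> Omega -> R) (xi : nat -> Omega -> 'I_N)
  (nu : probability (measurableTypeR R) R) (q : 'I_N -> R).

Definition rectangle (J K : seq nat) (A : nat -> set 'I_N) (B : nat -> set R) :
    set Omega :=
  \big[setI/setT]_(i <- J) (xi i @^-1` A i) `&`
  \big[setI/setT]_(i <- K) (S i @^-1` B i).

(** The probability that [rectangle] has when all its coordinates are
    independent and the holding times have law [nu]. *)
Definition rectangle_weight (J K : seq nat) (A : nat -> set 'I_N)
    (B : nat -> set R) : \bar R :=
  (\prod_(i <- J) P (xi i @^-1` A i)) * \prod_(i <- K) nu (B i).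

(** The mean of [Z] is the case of empty [J] and [K]. Two thresholds are kept
    because the modes are independent of the rest from index 1 on only, the
    holding times from index 0 on. *)
Definition decoupled (a b : nat) (Z : Omega -> R) (e : R) : Prop :=
  [/\ measurable_fun setT Z, forall w, (0 <= Z w)%R, (0 <= e)%R &
    forall (J K : seq nat) (A : nat -> set 'I_N) (B : nat -> set R),
      uniq J -> uniq K -> all (leq a) J -> all (leq b) K ->
      (forall i, measurable (B i)) ->
      \int[P]_(w in rectangle J K A B) (Z w)%:E =
      e%:E * rectangle_weight J K A B].

Hypothesis mS : forall i, measurable_fun setT (S i).
Hypothesis mxi : forall i A, measurable (xi i @^-1` A).
Hypothesis Pxi : forall i j, P (xi i @^-1` [set j]) = (q j)%:E.
Hypothesis indep : forall J K A B, uniq J -> uniq K -> all (leq 1) J ->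
  (forall i, measurable (B i)) ->
  P (rectangle J K A B) = rectangle_weight J K A B.

Lemma measurable_preimage_holding i (B : set R) :
  measurable B -> measurable (S i @^-1` B).
Proof. by move=> mB; rewrite -[_ @^-1` _]setTI; exact: mS. Qed.

Lemma measurable_rectangle J K A B : (forall i, measurable (B i)) ->
  measurable (rectangle J K A B).
Proof.
move=> mB; apply: measurableI; apply: bigsetI_measurable => i _; first exact: mxi.
exact: measurable_preimage_holding.
Qed.

Lemma rectangle_weight_fin J K A B : (forall i, measurable (B i)) ->
  rectangle_weight J K A B \is a fin_num.
Proof.
move=> mB; rewrite /rectangle_weight fin_numM //.
  elim/big_ind : _ => //; first exact: fin_numM.
  by move=> i _; exact: fin_num_measure.
elim/big_ind : _ => //; first exact: fin_numM.
by move=> i _; exact: (fin_num_measure nu _ (mB i)).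
Qed.

Lemma decoupled_one : decoupled 1 0 (fun=> 1%R) 1.
Proof.
split => // J K A B uJ uK aJ aK mB.
rewrite integral_cst; last exact: measurable_rectangle.
by congr (_ * _); exact: indep.
Qed.

Lemma decoupled_weaken a b a' b' Z e : (a <= a')%N -> (b <= b')%N ->
  decoupled a b Z e -> decoupled a' b' Z e.
Proof.
move=> aa bb [mZ Z0 e0 hZ]; split => // J K A B uJ uK aJ aK mB.
apply: hZ => //.
  by apply: sub_all aJ => i; exact: leq_trans.
by apply: sub_all aK => i; exact: leq_trans.
Qed.

Lemma decoupledD a b Z Z' e e' : decoupled a b Z e -> decoupled a b Z' e' ->
  decoupled a b (fun w => Z w + Z' w)%R (e + e').
Proof.
move=> [mZ Z0 e0 hZ] [mZ' Z0' e0' hZ']; split.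
- exact: measurable_funD.
- by move=> w; rewrite addr_ge0.
- by rewrite addr_ge0.
move=> J K A B uJ uK aJ aK mB.
under eq_integral do rewrite EFinD.
rewrite ge0_integralD //; first last.
- by apply: measurable_funTS; exact/measurable_EFinP.
- by move=> w _; rewrite lee_fin.
- by apply: measurable_funTS; exact/measurable_EFinP.
- by move=> w _; rewrite lee_fin.
- exact: measurable_rectangle.
by rewrite hZ // hZ' // EFinD ge0_muleDl.
Qed.

Lemma decoupledZ a b k Z e : (0 <= k)%R -> decoupled a b Z e ->
  decoupled a b (fun w => k * Z w)%R (k * e).
Proof.
move=> k0 [mZ Z0 e0 hZ]; split.
- exact: measurable_funM.
- by move=> w; rewrite mulr_ge0.
- by rewrite mulr_ge0.
move=> J K A B uJ uK aJ aK mB.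
under eq_integral do rewrite EFinM.
rewrite ge0_integralZl_EFin //.
- by rewrite hZ // EFinM muleA.
- exact: measurable_rectangle.
- by move=> w _; rewrite lee_fin.
- by apply: measurable_funTS; exact/measurable_EFinP.
Qed.

Lemma decoupled_sum a b (I : eqType) (s : seq I) (Z : I -> Omega -> R) (e : I -> R) :
  (forall i, decoupled a b (Z i) (e i)) ->
  decoupled a b (fun w => \sum_(i <- s) Z i w)%R (\sum_(i <- s) e i)%R.
Proof.
move=> hZ; elim: s => [|i s IHs].
  under eq_fun do rewrite big_nil.
  rewrite big_nil; split => // J K A B *.
  by rewrite mul0e; exact: integral0.
under eq_fun do rewrite big_cons.
by rewrite big_cons; exact: decoupledD.
Qed.

(** For fixed later coordinates, letting the set for [S b] vary gives the
    hypothesis of [integral_decouple]. *)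
Lemma decoupled_holding a b (phi : R -> R) (r : R) Z e :
  measurable_fun setT phi -> (forall t, (0 <= phi t)%R) ->
  \int[nu]_t (phi t)%:E = r%:E -> decoupled a b Z e ->
  decoupled a b.+1 (fun w => phi (S b w) * Z w)%R (e * r).
Proof.
move=> mphi phi0 phir [mZ Z0 e0 hZ]; split.
- by apply: measurable_funM => //; exact: measurableT_comp mphi (mS b).
- by move=> w; rewrite mulr_ge0.
- rewrite mulr_ge0 // -lee_fin -phir; apply: integral_ge0 => t _.
  by rewrite lee_fin.
move=> J K A B uJ uK aJ bK mB.
have bNK : b \notin K.
  by apply/negP => /(allP bK); rewrite ltnn.
rewrite (@integral_decouple _ _ _ (measurableTypeR R) _ P nu _ (S b) Z
  (e%:E * rectangle_weight J K A B)) //.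
- by rewrite phir EFinM muleAC.
- exact: measurable_rectangle.
- exact: mS.
- by rewrite fin_numM // rectangle_weight_fin.
move=> B' mB'; pose B2 i := if i == b then B' else B i.
have B2K i : i \in K -> B2 i = B i.
  by move=> iK; rewrite /B2; case: eqP => // ib; move: bNK; rewrite -ib iK.
have -> : rectangle J K A B `&` S b @^-1` B' = rectangle J (b :: K) A B2.
  rewrite /rectangle big_cons /B2 eqxx -setIA; congr (_ `&` _).
  rewrite setIC; congr (_ `&` _).
  by apply: eq_big_seq => i iK; rewrite -/(B2 i) B2K.
rewrite hZ //=.
- rewrite /rectangle_weight big_cons {1}/B2 eqxx.
  rewrite -[RHS]muleA; congr (_ * _); rewrite -muleA; congr (_ * _).
  rewrite muleC; congr (_ * _).
  by apply: eq_big_seq => i iK; rewrite B2K.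
- by rewrite bNK.
- by rewrite leqnn; apply: sub_all bK => i; exact: ltnW.
- by move=> i; rewrite /B2; case: ifP.
Qed.

(** The indicator of a mode merely adds one more side to the rectangle. *)
Lemma decoupled_mode a b j Z e : decoupled a b Z e ->
  decoupled a.+1 b (fun w => (xi a w == j)%:R * Z w)%R (e * q j).
Proof.
move=> [mZ Z0 e0 hZ].
have ind w : ((xi a w == j)%:R)%R = \1_(xi a @^-1` [set j]) w :> R.
  rewrite indicE; congr (nat_of_bool _)%:R.
  by apply/eqP/idP => [h|/set_mem //]; exact/mem_set.
split.
- apply: measurable_funM => //.
  by rewrite (_ : (fun w => _) = \1_(xi a @^-1` [set j])) //; apply/funext.
- by move=> w; rewrite mulr_ge0.
- by rewrite mulr_ge0 // -lee_fin -(Pxi a).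
move=> J K A B uJ uK aJ bK mB.
have aNJ : a \notin J by apply/negP => /(allP aJ); rewrite ltnn.
pose A2 i := if i == a then [set j] else A i.
have A2J i : i \in J -> A2 i = A i.
  by move=> iJ; rewrite /A2; case: eqP => // ia; move: aNJ; rewrite -ia iJ.
transitivity (\int[P]_(w in rectangle (a :: J) K A2 B) (Z w)%:E).
  have -> : rectangle (a :: J) K A2 B = rectangle J K A B `&` xi a @^-1` [set j].
    rewrite /rectangle big_cons {1}/A2 eqxx -setIA setIC; congr (_ `&` _ `&` _).
    by apply: eq_big_seq => i iJ; rewrite A2J.
  rewrite [RHS]integral_mkcondr; apply: eq_integral => w _.
  by rewrite ind indicE /patch; case: ifP; rewrite ?mul1r ?mul0r.
rewrite hZ //=.
- rewrite /rectangle_weight big_cons {1}/A2 eqxx Pxi EFinM -!muleA.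
  congr (_ * (_ * (_ * _))).
  by apply: eq_big_seq => i iJ; rewrite A2J.
- by rewrite aNJ.
- by rewrite leqnn; apply: sub_all aJ => i; exact: ltnW.
Qed.

Lemma decoupled_expectation a b Z e : decoupled a b Z e ->
  \int[P]_w (Z w)%:E = e%:E.
Proof.
move=> [_ _ _ /(_ [::] [::] (fun=> setT) (fun=> setT))].
by rewrite /rectangle /rectangle_weight !big_nil setIT !mule1; apply.
Qed.

End decoupled.

(** * Exponential moments of a uniform holding time *)

Lemma continuous_expR_linear (R : realType) (la : R) :
  continuous (fun t => expR (la * t)).
Proof.
move=> t; apply: continuous_comp; last exact: continuous_expR.
exact: mulrl_continuous.
Qed.

Lemma uniform_exp_moment (R : realType) (T : R) (T_gt0 : 0 < T) (la : R) :
  (\int[uniform_prob T_gt0]_t (expR (- la * t))%:E =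
   (one_minus_exp_quot (la * T))%:E)%E.
Proof.
have cexp := @continuous_expR_linear R (- la).
rewrite integral_uniform; last by move=> t; rewrite lee_fin expR_ge0.
  rewrite subr0 /one_minus_exp_quot.
  have [la0|la0] := eqVneq la 0.
    rewrite la0 mul0r eqxx.
    under eq_integral do rewrite oppr0 mul0r expR0.
    rewrite integral_cst //= mul1e lebesgue_measure_itv /= lte_fin T_gt0.
    by rewrite oppr0 adde0 -EFinM mulVf // gt_eqF.
  rewrite mulf_eq0 (negbTE la0) (gt_eqF T_gt0) /=.
  have dF (t : R) : is_derive t 1 (fun t => - la^-1 * expR (- la * t))
      (expR (- la * t)).
    have h : is_derive t 1 (fun t => expR (- la * t)) (expR (- la * t) * - la).
      have lin : is_derive t 1 (fun s => - la * s) (- la).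
        have := is_deriveZ (- la) (is_derive_id t 1).
        by rewrite /GRing.scale /= mulr1.
      exact: (is_derive1_comp (is_derive_expR (- la * t)) lin).
    have := is_deriveZ (- la^-1) h.
    by rewrite [_ *: (_ * _)]/GRing.scale /= mulrCA mulrNN mulVf // mulr1.
  have cF : continuous (fun t => - la^-1 * expR (- la * t)).
    move=> t; apply: differentiable_continuous.
    by apply/derivable1_diffP; exact: ex_derive.
  rewrite (@continuous_FTC2 _ (fun t => expR (- la * t))
    (fun t => - la^-1 * expR (- la * t))) //.
  - rewrite mulr0 expR0 -EFinB -EFinM; congr EFin.
    rewrite (mulNr la T); field.
    by rewrite la0 gt_eqF.
  - exact: continuous_subspaceT.
  - split.
    + by move=> z _; exact: ex_derive.
    + by apply/cvg_at_right_filter; exact: cF.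
    + by apply/cvg_at_left_filter; exact: cF.
  - by move=> z _; rewrite derive1E; exact: derive_val.
apply/measurable_EFinP; exact: continuous_measurable_fun.
Qed.

(** * Integrals, disturbances and comparison functions *)

(** The state at a random instant is not known to be measurable. The integral
    of a nonnegative function is a supremum over the simple functions below it,
    which makes it monotone without any measurability. *)
Lemma le_integral_pointwise (R : realType) (d : measure_display)
    (T : measurableType d) (mu : {measure set T -> \bar R}) (f g : T -> R) :
  (forall x, 0 <= f x) -> (forall x, f x <= g x) ->
  (\int[mu]_x (f x)%:E <= \int[mu]_x (g x)%:E)%E.
Proof.
move=> f0 fg; rewrite !ge0_integralTE; first last.
- by move=> x; rewrite lee_fin.
- by move=> x; rewrite lee_fin (le_trans (f0 x)).
apply: le_ereal_sup => _ /= [h hf <-]; exists h => // x.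
by apply: le_trans (hf x) _; rewrite lee_fin.
Qed.

Lemma disturbance_bound (R : realType) (p : nat) (d : R -> 'rV[R]_p) :
  ess_bounded_disturbance d ->
  0 <= fine (ess_norm `[0%R, +oo[ d) /\
  {ae (@lebesgue_measure R), forall t : R, 0 <= t ->
    enorm (d t) <= fine (ess_norm `[0%R, +oo[ d)}.
Proof.
move=> [_ doo].
have d0 : (0 <= ess_norm `[0%R, +oo[ d)%E.
  apply: ess_sup_gee.
    apply: (@lt_le_trans _ _ ((@lebesgue_measure R) `[0, 1]%classic)).
      by rewrite lebesgue_measure_itv /= lte_fin ltr01 oppr0 adde0 lte_fin.
    by apply: le_measure; rewrite ?inE //=.
  apply: nearW => t; rewrite /patch; case: ifP => // _.
  by rewrite lee_fin ge0_enorm.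
split; first exact: fine_ge0.
have := ess_sup_ge (@lebesgue_measure R) ((fun t => (enorm (d t))%:E) \_ `[0, +oo[).
move=> [M [mM M0 subM]]; exists M; split => //.
apply: subset_trans subM; apply: subsetC => t /= ht t0.
rewrite -lee_fin fineK; last by rewrite ge0_fin_numE.
move: ht; rewrite /patch ifT // inE /= in_itv /= t0 //.
Qed.

Lemma classK_ge0 (R : realType) (a : R -> R) r : classK a -> 0 <= r -> 0 <= a r.
Proof.
move=> [a0 inc _]; rewrite le_eqVlt => /orP[/eqP <-|r0]; first by rewrite a0.
by rewrite ltW // -a0 inc.
Qed.

Lemma classK_le (R : realType) (a : R -> R) r s : classK a ->
  0 <= r -> r <= s -> a r <= a s.
Proof.
move=> [a0 inc _] r0; rewrite le_eqVlt => /orP[/eqP ->//|rs].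
by rewrite ltW // inc.
Qed.

Lemma classK_scale (R : realType) (k : R) (a : R -> R) : 0 < k -> classK a ->
  classK (fun r => k * a r).
Proof.
move=> k0 [a0 inc ca]; split; first by rewrite a0 mulr0.
  by move=> r s r0 rs; rewrite ltr_pM2l // inc.
by move=> x; apply: cvgM; [exact: cvg_cst | exact: ca].
Qed.

Lemma classKinf_scale (R : realType) (k : R) (a : R -> R) : 0 < k ->
  classKinf a -> classKinf (fun r => k * a r).
Proof.
move=> k0 [aK aoo]; split; first exact: classK_scale.
move=> M; have [r r0 Mr] := aoo (M / k); exists r => //.
by rewrite mulrC -ltr_pdivrMr.
Qed.

Lemma classKL_exp (R : realType) (k c : R) (a : R -> R) : 0 < k -> 0 < c ->
  classK a -> classKL (fun r s => k * expR (- c * s) * a r).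
Proof.
move=> k0 c0 aK; split => [s s0|r r0].
  by apply: classK_scale aK; rewrite mulr_gt0 // expR_gt0.
split.
  move=> s t s0 st; apply: ler_wpM2r; first exact: classK_ge0.
  by rewrite ler_pM2l // ler_expR !mulNr lerN2 ler_pM2l.
rewrite -[X in _ --> X](mul0r (a r)); apply: cvgM; last exact: cvg_cst.
rewrite -[X in _ --> X](mulr0 k); apply: cvgM; first exact: cvg_cst.
under eq_fun do rewrite mulNr.
exact: (cvg_comp _ _ (gt0_cvgMry c0 cvg_id) (@cvgr_expR R)).
Qed.

(** * The majorant and its mean *)

Lemma sigma_of_seq_bigsetI (d : measure_display) (Omega : measurableType d)
    (E : Type) (B : set (set E)) (D : set nat) (X : nat -> Omega -> E)
    (J : seq nat) (C : nat -> set E) :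
  (forall i, i \in J -> D i /\ B (C i)) ->
  sigma_of_seq B D X (\big[setI/setT]_(i <- J) (X i @^-1` C i)).
Proof.
move=> hJ; rewrite big_seq.
pose G := \bigcup_(i in D) sigma_of B (X i).
pose mG := (@measurable _ (g_sigma_algebraType G)).
suff : mG (\big[setI/setT]_(i <- J | i \in J) (X i @^-1` C i)) by [].
apply: bigsetI_measurable => i /hJ [Di Bi].
apply: sub_gen_smallest; exists i => //; exists (C i) => //.
by rewrite setTI.
Qed.

Lemma UH_rectangle (dsp : measure_display) (Omega : measurableType dsp)
    (R : realType) (P : probability Omega R) (N : nat)
    (sigma : R -> Omega -> 'I_N) (tau : nat -> Omega -> R)
    (T : R) (T_gt0 : 0 < T) (q : 'I_N -> R) (J K : seq nat)
    (A : nat -> set 'I_N) (B : nat -> set R) :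
  classUH P sigma tau T_gt0 q -> uniq J -> uniq K -> all (leq 1) J ->
  (forall i, measurable (B i)) ->
  P (rectangle (holding_time tau) (switch_value sigma tau) J K A B) =
  rectangle_weight P (switch_value sigma tau) (uniform_prob T_gt0) J K A B.
Proof.
move=> [[mS iS dS] [q01 mxi ixi dxi] indep] uJ uK J1 mB.
rewrite /rectangle setIC indep; first last.
- by apply: sigma_of_seq_bigsetI => i /(allP J1) i1; split.
- by apply: sigma_of_seq_bigsetI => i _; split => //; exact: mB.
rewrite muleC /rectangle_weight; congr (_ * _)%E.
  by apply: ixi => // i _; exists (A i) => //; rewrite setTI.
rewrite iS //; first by apply: eq_bigr => i _; rewrite dS //; exact: mB.
by move=> i _; exists (B i); [exact: mB | rewrite setTI].
Qed.

Lemma affine_recursion_le (R : realType) (e : nat -> R) (eta b : R) :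
  0 <= eta -> eta < 1 -> 0 <= b -> (forall i, e i.+1 = eta * e i + b) ->
  forall i, e i <= eta ^+ i * e 0%N + b / (1 - eta).
Proof.
move=> eta0 eta1 b0 eS; have d0 : 0 < 1 - eta by rewrite subr_gt0.
elim => [|i IHi]; first by rewrite expr0 mul1r lerDl divr_ge0 // ltW.
rewrite eS exprS -mulrA.
have := ler_wpM2l eta0 IHi; rewrite mulrDr.
have : eta * (b / (1 - eta)) + b = b / (1 - eta).
  by field; rewrite gt_eqF.
by lra.
Qed.

Section majorant.
Context (dsp : measure_display) (Omega : measurableType dsp) (R : realType)
  (N : nat).
Variables (S : nat -> Omega -> R) (xi : nat -> Omega -> 'I_N).
Variables (mu Lam : R) (lambda : 'I_N -> R) (v0 c : R).

(** The solution of [majorantS], the recursion dominating the energy just after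
    the switching instant of index i + 1. The coefficient is split according to
    the current mode so that every summand is a product of an indicator of the
    mode and a function of the holding time. *)
Fixpoint majorant (i : nat) (w : Omega) : R :=
  if i is i'.+1 then
    \sum_(j < N) (xi i w == j)%:R *
                 (expR (- lambda j * S i w) * (mu * majorant i' w))
    + c * mu * expR (Lam * S i w)
  else mu * (v0 + c) * expR (Lam * S 0%N w).

Lemma majorantS i w : majorant i.+1 w =
  mu * expR (- lambda (xi i.+1 w) * S i.+1 w) * majorant i w
  + c * mu * expR (Lam * S i.+1 w).
Proof.
rewrite /= (bigD1 (xi i.+1 w)) //= eqxx mul1r big1 ?addr0.
  by rewrite mulrCA mulrA.
by move=> j /negbTE; rewrite eq_sym => ->; rewrite mul0r.
Qed.

Variables (P : probability Omega R) (T : R) (T_gt0 : 0 < T) (q : 'I_N -> R).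
Hypotheses (mu_ge0 : 0 <= mu) (v0_ge0 : 0 <= v0) (c_ge0 : 0 <= c).
Hypothesis mS : forall i, measurable_fun setT (S i).
Hypothesis mxi : forall i A, measurable (xi i @^-1` A).
Hypothesis Pxi : forall i j, P (xi i @^-1` [set j]) = (q j)%:E.
Hypothesis indep : forall J K A B, uniq J -> uniq K -> all (leq 1) J ->
  (forall i, measurable (B i)) ->
  P (rectangle S xi J K A B) = rectangle_weight P xi (uniform_prob T_gt0) J K A B.

Local Notation decoupled := (decoupled P S xi (uniform_prob T_gt0)).
Let kappa := one_minus_exp_quot (- Lam * T).
Let eta := \sum_(j < N) mu * q j * one_minus_exp_quot (lambda j * T).

Let measurable_exp la : measurable_fun setT (fun t : R => expR (la * t)).
Proof. by apply: continuous_measurable_fun; exact: continuous_expR_linear. Qed.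

Lemma decoupled_growth i :
  decoupled 1 i.+1 (fun w => expR (Lam * S i w)) kappa.
Proof.
have one := decoupled_weaken (leqnn 1) (leq0n i) (decoupled_one mS mxi indep).
have moment : (\int[uniform_prob T_gt0]_t (expR (Lam * t))%:E = kappa%:E)%E.
  by rewrite -(uniform_exp_moment T_gt0); apply: eq_integral => t _; rewrite opprK.
have := decoupled_holding mS mxi (measurable_exp Lam) (fun t => expR_ge0 _)
  moment one.
by rewrite mul1r; under eq_fun do rewrite mulr1.
Qed.

Fixpoint majorant_mean (i : nat) : R :=
  if i is i'.+1 then eta * majorant_mean i' + c * mu * kappa
  else mu * (v0 + c) * kappa.

(** The majorant of index i involves the modes 1, ..., i and the holding times
    0, ..., i, hence both thresholds i + 1. *)
Lemma decoupled_majorant i : decoupled i.+1 i.+1 (majorant i) (majorant_mean i).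
Proof.
elim: i => [|i IHi].
  by apply: decoupledZ (decoupled_growth 0); rewrite // mulr_ge0 // addr_ge0.
rewrite [majorant_mean _]/= /eta mulr_suml.
apply: decoupledD => //; last first.
  apply: decoupledZ => //; first by rewrite mulr_ge0.
  exact: decoupled_weaken (decoupled_growth i.+1).
apply: decoupled_sum => // j.
have -> : mu * q j * one_minus_exp_quot (lambda j * T) * majorant_mean i =
    mu * majorant_mean i * one_minus_exp_quot (lambda j * T) * q j by ring.
apply: decoupled_mode => //.
have step := decoupledZ mS mxi mu_ge0 IHi.
exact: (decoupled_holding mS mxi (measurable_exp (- lambda j))
  (fun t => expR_ge0 _) (uniform_exp_moment T_gt0 (lambda j)) step).
Qed.

Lemma majorant_expectation i :
  0 <= eta -> eta < 1 ->
  (\int[P]_w (majorant i w)%:E <=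
   (mu * (v0 + c) * kappa * eta ^+ i + c * mu * kappa / (1 - eta))%:E)%E.
Proof.
move=> eta0 eta1; rewrite (decoupled_expectation (decoupled_majorant i)) lee_fin.
have kappa0 : 0 <= kappa by have [_ _] := decoupled_growth 0.
rewrite mulrC.
apply: (affine_recursion_le eta0 eta1 _ (e := majorant_mean)) => //.
by rewrite !mulr_ge0.
Qed.

End majorant.

(** * Domination along a path and the estimate *)

Lemma abs_continuous_on_right (R : realType) n (a b : R) (y : R -> 'rV[R]_n) :
  0 <= a -> abs_continuous_on 0 b y -> abs_continuous_on a b y.
Proof.
move=> a0 ACy e e0; have [del del0 hdel] := ACy e e0.
exists del => // K l r lr; apply: hdel => i.
by have [al ? ?] := lr i; split => //; exact: le_trans al.
Qed.

Lemma measurable_fun_random_element (dsp : measure_display)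
    (Omega : measurableType dsp) (R : realType) (X : Omega -> R) :
  random_element measurable X -> measurable_fun setT X.
Proof. by move=> hX _ B mB; apply: hX; exists B. Qed.

Section pathwise.
Context (dsp : measure_display) (Omega : measurableType dsp) (R : realType)
  (N n p : nat).
Variables (F : 'I_N -> 'rV[R]_n -> 'rV[R]_p -> 'rV[R]_n)
  (sigma : R -> Omega -> 'I_N) (tau : nat -> Omega -> R)
  (V : 'I_N -> 'rV[R]_n -> R) (chi : R -> R) (lambda : 'I_N -> R) (mu : R)
  (d : R -> 'rV[R]_p) (x0 : 'rV[R]_n) (x : R -> Omega -> 'rV[R]_n) (D v0 : R).
Hypotheses (tau_instants : switching_instants sigma tau)
  (V_C1 : forall i, classC 1 (V i)) (V_ge0 : forall i y, 0 <= V i y)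
  (chi_K : classK chi) (mu_ge1 : 1 <= mu)
  (V_compare : forall i j y, V i y <= mu * V j y)
  (dissipation : forall i y e,
     'd (V i) y (F i y e) <= - lambda i * V i y + chi (enorm e))
  (x_sol : solution F sigma d x0 x) (D_ge0 : 0 <= D)
  (d_le : {ae (@lebesgue_measure R), forall t : R, 0 <= t -> enorm (d t) <= D})
  (v0_ge : forall i, V i x0 <= v0).

Local Notation S := (holding_time tau).
Local Notation xi := (switch_value sigma tau).
Let rate := \sum_(j < N) `|lambda j|.

Lemma switching_instant_ge0 i w : 0 <= tau i w.
Proof.
have [tau0 tauS _] := tau_instants.
by elim: i => [|i IHi]; [rewrite tau0 | exact: le_trans (tauS i w)].
Qed.

Lemma rate_ge j : `|lambda j| <= rate.
Proof. by rewrite /rate (bigD1 j) //= lerDl sumr_ge0. Qed.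

Lemma holding_interval_bound i w :
  V (xi i w) (x (tau i.+1 w) w) <=
  expR (- lambda (xi i w) * S i w) * V (xi i w) (x (tau i w) w)
  + chi D * expR ((rate * 2 + 1) * S i w).
Proof.
have [tau0 tauS tau_cst] := tau_instants.
have [_ /(_ w) [_ ACx [M1 [mM1 M10 sub1]]]] := x_sol.
have [M2 [mM2 M20 sub2]] := d_le.
have ti0 := switching_instant_ge0 i w.
apply: (@dissipation_bound _ _ (V (xi i w)) (x ^~ w)) => //.
- apply: abs_continuous_on_right => //; apply: ACx.
  exact: switching_instant_ge0.
- exact: rate_ge.
- exact: classK_ge0.
exists (M1 `|` M2); split; first by apply: measurableU.
  by rewrite measureU0.
rewrite -[M1 `|` M2]setCK; apply: subsetC.
rewrite setCU => t [tM1 tM2] /= /andP[at_ tb].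
have t0 : 0 <= t by exact: le_trans ti0 (ltW at_).
have dt : enorm (d t) <= D.
  by apply: contrapT => nd; apply: tM2; apply: sub2 => /= h; apply: nd; exact: h.
have dx : is_derive t 1 (x ^~ w) (F (sigma t w) (x t w) (d t)).
  by apply: contrapT => nd; apply: tM1; apply: sub1 => /= h; apply: nd; exact: h.
rewrite (tau_cst i w t (ltW at_) tb) in dx.
exists (F (xi i w) (x t w) (d t)) => //.
apply: le_trans (dissipation _ _ _) _; rewrite lerD2l.
by apply: classK_le => //; exact: ge0_enorm.
Qed.

(** The initial mode is not controlled, so in the first step
    exp(-lambda S_0) is replaced by the exponential with the common rate;
    afterwards the recursion matches the one-step bound exactly. *)
Lemma majorant_ge_path i w :
  V (xi i.+1 w) (x (tau i.+1 w) w) <=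
  majorant S xi mu (rate * 2 + 1) lambda v0 (chi D) i w.
Proof.
have [tau0 tauS _] := tau_instants.
have S0 j : 0 <= S j w by rewrite subr_ge0.
have mu0 : 0 <= mu by exact: le_trans mu_ge1.
have step j : V (xi j.+1 w) (x (tau j.+1 w) w) <=
    mu * expR (- lambda (xi j w) * S j w) * V (xi j w) (x (tau j w) w)
    + chi D * mu * expR ((rate * 2 + 1) * S j w).
  apply: le_trans (V_compare _ (xi j w) _) _.
  apply: le_trans (ler_wpM2l mu0 (holding_interval_bound j w)) _.
  by rewrite mulrDr !mulrA (mulrC mu (chi D)).
elim: i => [|i IHi].
  apply: le_trans (step 0%N) _; rewrite /= tau0.
  have [_ /(_ w) [-> _ _]] := x_sol.
  have -> : mu * (v0 + chi D) * expR ((rate * 2 + 1) * S 0%N w) =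
      mu * expR ((rate * 2 + 1) * S 0%N w) * v0
      + chi D * mu * expR ((rate * 2 + 1) * S 0%N w) by ring.
  rewrite lerD2r; apply: ler_pM => //; first by rewrite mulr_ge0 // expR_ge0.
  rewrite ler_wpM2l // ler_expR ler_wpM2r //.
  have := rate_ge (xi 0%N w); rewrite ler_norml => /andP[].
  have : 0 <= rate by exact: sumr_ge0.
  by lra.
apply: le_trans (step i.+1) _; rewrite majorantS lerD2r.
by apply: ler_wpM2l IHi; rewrite mulr_ge0 // expR_ge0.
Qed.

End pathwise.

Theorem proposition10 (R : realType) (dsp : measure_display)
    (Omega : measurableType dsp) (P : probability Omega R)
    (N n p m : nat)
    (f : 'I_N -> 'rV[R]_n * 'rV[R]_p -> 'rV[R]_n)
    (g : 'I_N -> 'I_m -> 'rV[R]_n -> 'rV[R]_n)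
    (f_smooth : forall j, smooth (f j))
    (g_smooth : forall j l, smooth (g j l))
    (sigma : R -> Omega -> 'I_N) (tau : nat -> Omega -> R)
    (sigma_switching : random_switching_signal sigma)
    (tau_instants : switching_instants sigma tau)
    (T : R) (T_gt0 : 0 < T) (q : 'I_N -> R)
    (UH : classUH P sigma tau T_gt0 q)
    (V : 'I_N -> 'rV[R]_n -> R)
    (V_ge0 : forall i x, 0 <= V i x)
    (V_C1 : forall i, classC 1 (V i))
    (alpha1 alpha2 chi : R -> R)
    (alpha1_Kinf : classKinf alpha1)
    (alpha2_Kinf : classKinf alpha2)
    (chi_Kinf : classKinf chi)
    (mu : R) (mu_ge1 : 1 <= mu) (lambda : 'I_N -> R)
    (CUd1_bounds : forall i x,
       alpha1 (enorm x) <= V i x /\ V i x <= alpha2 (enorm x))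
    (CUd1_compare : forall i j x, V i x <= mu * V j x)
    (k : 'rV[R]_n -> 'rV[R]_m)
    (CUd2 : forall i x d,
       'd (V i) x (closed_loop f g k i x d)
         <= - lambda i * V i x + chi (enorm d))
    (CUd3 : \sum_(i < N) mu * q i * one_minus_exp_quot (lambda i * T) < 1) :
  ISS_L1_at_switching P (closed_loop f g k) sigma tau.
Proof.
have [alpha1K _] := alpha1_Kinf; have [alpha2K _] := alpha2_Kinf.
have [chiK _] := chi_Kinf.
have [[mS _ _] [q01 mxi _ Pxi] _] := UH.
have mu0 : 0 <= mu by exact: le_trans mu_ge1.
pose eta := \sum_(i < N) mu * q i * one_minus_exp_quot (lambda i * T).
pose Lam := (\sum_(j < N) `|lambda j|) * 2 + 1.
have quot_ge0 la : 0 <= one_minus_exp_quot (la * T).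
  rewrite -lee_fin -(uniform_exp_moment T_gt0); apply: integral_ge0 => t _.
  by rewrite lee_fin expR_ge0.
have eta0 : 0 <= eta.
  apply: sumr_ge0 => i _; rewrite mulr_ge0 // mulr_ge0 //.
  by have /andP[/ltW] := q01 i.
pose kappa := one_minus_exp_quot (- Lam * T).
have kappa0 : 0 <= kappa by exact: quot_ge0.
(* Any ratio in [eta, 1[ would do; the midpoint is visibly positive. *)
pose rho := (1 + eta) / 2.
have eta1 : eta < 1 := CUd3.
have rho0 : 0 < rho by rewrite /rho; lra.
have rho1 : rho < 1 by rewrite /rho; lra.
have eta_rho : eta <= rho by rewrite /rho; lra.
pose gain := mu * kappa + 1.
have gain0 : 0 < gain by rewrite ltr_wpDl // mulr_ge0.
have mk0 : 0 <= mu * kappa by rewrite mulr_ge0.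
pose noise := mu * kappa + mu * kappa / (1 - eta) + 1.
have noise0 : 0 < noise.
  by rewrite ltr_wpDl // addr_ge0 // divr_ge0 // subr_ge0 ltW.
(* The first interval contributes no factor eta, so the power available is
   nu - 1; dividing by rho makes up for it. *)
exists (fun r s => gain / rho * expR (- - ln rho * s) * alpha2 r), alpha1,
  (fun r => noise * chi r).
split => //.
- apply: classKL_exp => //; first by rewrite divr_gt0.
  by rewrite oppr_gt0 ln_lt0 // rho0.
- exact: classKinf_scale.
move=> x0 d x _ d_bounded x_sol [//|nu] _.
have [D0 dD] := disturbance_bound d_bounded.
set D := fine _ in D0 dD *.
have cD0 : 0 <= chi D by exact: classK_ge0.
have v00 : 0 <= alpha2 (enorm x0) by apply: classK_ge0 => //; exact: ge0_enorm.
pose W := majorant (holding_time tau) (switch_value sigma tau) mu Lam lambda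
  (alpha2 (enorm x0)) (chi D).
rewrite unlock; apply: (@le_trans _ _ (\int[P]_w (W nu w)%:E)%E).
  apply: le_integral_pointwise => w.
    by apply: classK_ge0 => //; exact: ge0_enorm.
  apply: le_trans (CUd1_bounds (switch_value sigma tau nu.+1 w) _).1 _.
  apply: (majorant_ge_path tau_instants V_C1 V_ge0 chiK mu_ge1 CUd1_compare CUd2
    x_sol D0 dD) => i.
  exact: (CUd1_bounds i x0).2.
have mS' i := measurable_fun_random_element (mS i).
have mxi' i A : measurable (switch_value sigma tau i @^-1` A).
  by apply: (mxi i); exists A => //; rewrite setTI.
apply: le_trans (majorant_expectation Lam mu0 v00 cD0 mS' mxi' Pxi
  (fun J K A B => @UH_rectangle _ _ _ _ _ _ _ _ _ _ J K A B UH) nu eta0 eta1) _.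
rewrite lee_fin -/kappa -/eta.
have -> : gain / rho * expR (- - ln rho * nu.+1%:R) = gain * rho ^+ nu.
  rewrite opprK expRM_natr lnK ?posrE // exprS.
  by field; rewrite gt_eqF.
set v := alpha2 _ in v00 *; set c := chi D in cD0 *.
have pow_le : eta ^+ nu <= rho ^+ nu by rewrite lerXn2r // ?nnegrE // ltW.
have pow_le1 : eta ^+ nu <= 1 by rewrite exprn_ile1 // ltW.
have init_le : mu * kappa * eta ^+ nu * v <= gain * rho ^+ nu * v.
  apply: ler_wpM2r => //; apply: ler_pM => //; first exact: exprn_ge0.
  by rewrite /gain lerDl.
have noise_le : mu * kappa * eta ^+ nu * c <= mu * kappa * c.
  by apply: ler_wpM2r => //; rewrite ler_piMr.
pose z := mu * kappa / (1 - eta).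
have -> : noise * c = mu * kappa * c + z * c + c by rewrite /noise /z; ring.
have -> : mu * (v + c) * kappa * eta ^+ nu + c * mu * kappa / (1 - eta) =
    mu * kappa * eta ^+ nu * v + mu * kappa * eta ^+ nu * c + z * c.
  by rewrite /z; ring.
by lra.
Qed.
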